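(* Let $G$ be a finitely presented group and let $\Gamma$ be a finite solvable group. Let $E$ be an elementary abelian $q$-group ($q$ prime) which is a minimal normal subgroup of $\Gamma$, and let $B=\Gamma/E$. Let $\sigma\colon B\to\mathrm{Aut}(E)$ be the monodromy and $\chi\colon B\times B\to E$ the normalized $2$-cocycle defining the extension $1\to E\to\Gamma\to B\to 1$. Then $$|\mathrm{Epi}(G,\Gamma)|=|E|^{\zeta}\sum_{\rho\in\mathrm{Epi}(G,B)}\left(\epsilon_{\chi}(\rho)\,q^{\dim_{\mathbb{Z}_q}H^{1}_{\sigma\rho}(G,E)}-c_{\chi}\,q^{\kappa(\alpha-1)}\right),$$ where: - $\zeta=0$ if $B$ acts trivially on $E$, and $\zeta=1$ otherwise; - $\epsilon_\chi(\rho)=1$ if the equation $\delta^1 f=-\rho^*\chi$ has a solution $f\colon G\to E$, and $\epsilon_\chi(\rho)=0$ otherwise; - $c_\chi=1$ if $[\chi]=0$ in $H^2_\sigma(B,E)$, and $c_\chi=0$ otherwise; - $\alpha$ is the number of complemented chief factors of $\Gamma$ isomorphic to $E$ as $\Gamma$-modules (under the conjugation action); - $\kappa$ is defined by $q^{\kappa}=|\mathrm{End}_{\Gamma}(E)|$.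
   Context: $\mathrm{Epi}(G,\Gamma)$ denotes the set of surjective homomorphisms $G\to\Gamma$, and $\mathbb{Z}_q=\mathbb{Z}/q\mathbb{Z}$. Abelian groups are written additively. For an extension $1\to A\xrightarrow{i}\Gamma\xrightarrow{\pi} B\to1$ with $A$ abelian and a set section $s\colon B\to\Gamma$ of $\pi$ with $s(1)=1$, the monodromy $\sigma\colon B\to\mathrm{Aut}(A)$ is defined by $i(\sigma_b(a))=s(b)i(a)s(b)^{-1}$, and the $2$-cocycle $\chi$ by $i(\chi(b,b'))=s(b)s(b')s(bb')^{-1}$. For $\rho\colon G\to B$, $A$ is a $G$-module via $\sigma\rho$, and $H^1_{\sigma\rho}(G,A)$ is group cohomology with these coefficients. For $f\colon G\to A$, $(\delta^1 f)(g,h)=\sigma_{\rho(g)}(f(h))-f(gh)+f(g)$, and $(\rho^*\chi)(g,h)=\chi(\rho(g),\rho(h))$. The chief factors of $\Gamma$ are the quotients $H/K$ of consecutive terms of a chief series of $\Gamma$ (a maximal chain of normal subgroups of $\Gamma$), counted with multiplicity. A chief factor $H/K$ is complemented if it has a complement in $\Gamma/K$. $\mathrm{End}_\Gamma(E)$ is the ring of $\Gamma$-module endomorphisms of $E$. *)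

(* Defs.v *)
From HB Require Import structures.
From mathcomp Require Import all_boot all_order all_algebra all_fingroup
  all_solvable all_field all_character.
From mathcomp Require Import generic_quotient ring_quotient.
From mathcomp Require Import boolp classical_sets functions cardinality.
From mathcomp Require Import fsbigop.

Set Implicit Arguments.
Unset Strict Implicit.
Unset Printing Implicit Defensive.

Import GroupScope GRing.Theory.

Local Open Scope ring_scope.
Local Open Scope abelem_scope.
Local Open Scope quotient_scope.

(* [(i, true)] is the letter x_i and [(i, false)] the letter x_i^-1. *)
Definition word (n : nat) := seq ('I_n * bool).

Definition word_eval (G : groupType) (n : nat) (x : 'I_n -> G) (w : word n) : G :=
  foldr (fun l g => ((if l.2 then x l.1 else (x l.1)^-1) * g)%g) 1%g w.

(* The group < x_0, ..., x_(n-1) | r >, as the quotient of the free monoid on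
   the letters by the least congruence that cancels x x^-1 and x^-1 x and kills
   the relators. *)
Inductive word_eq (n : nat) (r : seq (word n)) : word n -> word n -> Prop :=
| WordRefl u : word_eq r u u
| WordSym u v : word_eq r u v -> word_eq r v u
| WordTrans u v w : word_eq r u v -> word_eq r v w -> word_eq r u w
| WordCat u u' v v' :
    word_eq r u u' -> word_eq r v v' -> word_eq r (u ++ v) (u' ++ v')
| WordCancel i b : word_eq r [:: (i, b); (i, ~~ b)] [::]
| WordRelator u : u \in r -> word_eq r u [::].

Definition finitely_presented (G : groupType) : Prop :=
  exists (n : nat) (r : seq (word n)) (x : 'I_n -> G),
    (forall g, exists w, word_eval x w = g) /\
    (forall u v, word_eval x u = word_eval x v <-> word_eq r u v).

Definition Epi (G H : groupType) : set (G -> H) :=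
  [set f : G -> H | {morph f : x y / (x * y)%g} /\ range f = setT]%classic.
Arguments Epi : clear implicits.

(* Cardinals and sums over [Epi G H] are taken with [fset_set] and fsbigop,
   which return 0 on infinite sets; for the groups at hand the set is finite. *)
Lemma finite_Epi (G : groupType) (H : finGroupType) :
  finitely_presented G -> finite_set (Epi G H).
Proof.
move=> [n [r [x [genx _]]]].
pose ev (f : G -> H) : {ffun 'I_n -> H} := [ffun i => f (x i)].
have injev : {in Epi G H &, injective ev}.
  move=> f f'; rewrite !inE => -[fM _] [f'M _] eqf.
  have f1 (h : G -> H) : {morph h : y z / (y * z)%g} -> h 1%g = 1%g.
    by move=> hM; apply: (mulgI (h 1%g)); rewrite -hM !mulg1.
  have fV (h : G -> H) y : {morph h : y z / (y * z)%g} -> h y^-1%g = (h y)^-1%g.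
    by move=> hM; apply: (mulgI (h y)); rewrite -hM !mulgV f1.
  apply/funext => g; have [w <-] := genx g.
  elim: w => [|[i b] w IHw] /=; first by rewrite !f1.
  rewrite fM f'M IHw; congr (_ * _)%g.
  have fxi : f (x i) = f' (x i) by move/ffunP/(_ i): eqf; rewrite !ffunE.
  by case: b; rewrite // !fV // fxi.
pose g v := xget (fun=> 1%g) [set f | Epi G H f /\ ev f = v]%classic.
apply: (@sub_finite_set _ _ (range g)); last first.
  exact/finite_image/finite_finset.
move=> f Ef; exists (ev f) => //; rewrite /g.
case: xgetP => [f' _ [Ef' eqf]|/(_ f)[]//].
by apply: injev; rewrite ?inE.
Qed.

Section QuotientModule.
Variables (R : nzRingType) (V : lmodType R) (W : {pred V}).
Hypothesis W_submod : submod_closed W.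

Definition submod_pred of submod_closed W : {pred V} := W.
HB.instance Definition _ (W_closed : submod_closed W) :=
  GRing.isSubmodClosed.Build R V (submod_pred W_closed) W_closed.

Definition quotmod : Type := Quotient.quot (submod_pred W_submod).

HB.instance Definition _ := GRing.Zmodule.on quotmod.
HB.instance Definition _ := EqQuotient.on quotmod.

Definition quotmod_scale (a : R) : quotmod -> quotmod :=
  lift_op1 quotmod ( *:%R a).

Lemma pi_quotmod_scale a :
  {morph \pi_quotmod : v / a *: v >-> quotmod_scale a v}.
Proof.
move=> v; unlock quotmod_scale; apply/eqP.
rewrite piE Quotient.equivE -scalerBr rpredZ //.
by rewrite Quotient.idealrBE reprK.
Qed.

Fact quotmod_scalerA a b x :
  quotmod_scale a (quotmod_scale b x) = quotmod_scale (a * b) x.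
Proof. by rewrite -[x]reprK -!pi_quotmod_scale scalerA. Qed.

Fact quotmod_scale1r : left_id 1 quotmod_scale.
Proof. by move=> x; rewrite -[x]reprK -pi_quotmod_scale scale1r. Qed.

Fact quotmod_scalerDr : right_distributive quotmod_scale +%R.
Proof.
move=> a x y; rewrite -[x]reprK -[y]reprK -!pi_quotmod_scale.
by rewrite -!(raddfD \pi_quotmod) -pi_quotmod_scale scalerDr.
Qed.

Fact quotmod_scalerDl x :
  {morph (fun a => quotmod_scale a x) : a b / a + b}.
Proof.
move=> a b; rewrite -[x]reprK -!pi_quotmod_scale scalerDl.
exact: (raddfD \pi_quotmod).
Qed.

HB.instance Definition _ := GRing.Zmodule_isLmodule.Build R quotmod
  quotmod_scalerA quotmod_scale1r quotmod_scalerDr quotmod_scalerDl.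

End QuotientModule.

(* [Vector.axiom n M] is the existence of a linear bijection M -> R^n; the
   value is 0 if M is not finite-dimensional, which does not happen for the
   H^1 below when G is finitely generated and V is finite. *)
Definition lmod_dim (R : nzRingType) (M : lmodType R) : nat :=
  xget 0%N [set n | inhabited (Vector.axiom n M)]%classic.

Section Cohomology.
Variables (R : nzRingType) (G : groupType) (V : lmodType R).
Variable act : G -> {linear V -> V}.

Definition delta0 (v : V) : G -> V := fun g => act g v - v.

Definition delta1 (f : G -> V) : G -> G -> V :=
  fun g h => act g (f h) - f (g * h)%g + f g.

Definition Z1 : {pred G -> V} := fun f => `[< delta1 f = fun=> fun=> 0 >].

Fact Z1_submod : submod_closed Z1.
Proof.
split=> [|a f f' /asboolP df /asboolP df']; apply/asboolP;
  apply/funext => g; apply/funext => h; rewrite /delta1.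
  by rewrite -[RHS](raddf0 (act g)) !subr0 addr0.
have /(congr1 (@^~ h)) := congr1 (@^~ g) df.
have /(congr1 (@^~ h)) := congr1 (@^~ g) df'.
rewrite /delta1 /= => e' e.
have -> : act g ((a *: f + f') h) - (a *: f + f') (g * h)%g + (a *: f + f') g
  = a *: (act g (f h) - f (g * h)%g + f g) +
    (act g (f' h) - f' (g * h)%g + f' g).
  rewrite [(a *: f + f') h]/(a *: f h + f' h) linearP.
  rewrite [(a *: f + f') (g * h)%g]/(a *: f (g * h)%g + f' (g * h)%g).
  rewrite [(a *: f + f') g]/(a *: f g + f' g).
  by rewrite opprD !scalerDr scalerN [X in X + _ = _]addrACA [LHS]addrACA.
by rewrite e e' scaler0 addr0.
Qed.

HB.instance Definition _ := GRing.isSubmodClosed.Build R (G -> V) Z1 Z1_submod.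

Definition cocycle1 : Type := {f : G -> V | f \in Z1}.
HB.instance Definition _ := [isSub of cocycle1 for sval].
HB.instance Definition _ := [Choice of cocycle1 by <:].
HB.instance Definition _ := [SubChoice_isSubLmodule of cocycle1 by <:].

Definition B1 : {pred cocycle1} := fun z => `[< exists v, val z = delta0 v >].

Fact B1_submod : submod_closed B1.
Proof.
split=> [|a z z' /asboolP[v zE] /asboolP[v' z'E]]; apply/asboolP.
  by exists 0; rewrite raddf0; apply/funext => g; rewrite /delta0 linear0 subr0.
exists (a *: v + v').
have -> : val (a *: z + z') = a *: val z + val z' by exact: linearP.
rewrite zE z'E; apply/funext => g.
rewrite [LHS]/(a *: (act g v - v) + (act g v' - v')) /delta0.
by rewrite linearP scalerBr opprD addrACA.
Qed.

Definition H1 : lmodType R := quotmod B1_submod.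

(* [c] represents the zero class of H^2. *)
Definition coboundary2 (c : G -> G -> V) : Prop := exists f, c = delta1 f.

End Cohomology.

(* E written additively is the F_q-space 'rV(E); the isomorphism between the
   two is [abelem_rV]/[rVabelem]. As E is normal in Gamma = [set: Gamma], the
   type [coset_of E] is the whole quotient Gamma / E. *)
Section MinimalNormal.
Variables (q : nat) (Gamma : finGroupType) (E : {group Gamma}).
Hypotheses (abelE : q.-abelem E) (minE : minnormal E [set: Gamma]).

Fact minnormal_neq1 : E :!=: 1%g.
Proof. by case/mingroupP: minE => /andP[]. Qed.

Fact minnormal_norm (x : Gamma) : x \in 'N(E).
Proof.
case/mingroupP: minE => /andP[_ /fintype.subsetP/(_ x)] + _.
by apply; rewrite inE.
Qed.

Let V := 'rV['F_q](E).
Let toV : Gamma -> V := abelem_rV abelE minnormal_neq1.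
Let toE : V -> Gamma := rVabelem abelE minnormal_neq1.

Definition conjV (x : Gamma) (v : V) : V := toV (x * toE v * x^-1)%g.

Fact conjV_linear x : linear (conjV x).
Proof.
move=> a u v; rewrite /conjV /toE rVabelemD rVabelemZ.
have cE w : (x * toE w * x^-1)%g = (toE w ^ x^-1)%g by rewrite conjgE invgK mulgA.
have Jin w : (toE w ^ x^-1)%g \in E.
  by rewrite memJ_norm ?mem_rVabelem // groupV minnormal_norm.
rewrite !cE -[X in X *: _]natr_Zp -abelem_rV_X // -abelem_rV_M ?groupX //.
rewrite -conjXg -conjMg.
by rewrite [in RHS]conjgE invgK !mulgA.
Qed.

HB.instance Definition _ x :=
  GRing.isLinear.Build 'F_q V V *:%R (conjV x) (conjV_linear x).

Definition EndGamma : {set {ffun V -> V}} :=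
  [set f : {ffun V -> V} | [forall u, forall v, f (u + v) == f u + f v]
                        && [forall x, forall v, f (conjV x v) == conjV x (f v)]].

Variable s : coset_of E -> Gamma.

Definition monodromy (b : coset_of E) : {linear V -> V} := conjV (s b).

Definition ext_cocycle (b b' : coset_of E) : V :=
  toV (s b * s b' * (s (b * b'))^-1)%g.

Definition acts_trivially : bool := [forall b, forall v, monodromy b v == v].

End MinimalNormal.

Section ChiefFactors.
Variables (Gamma : finGroupType) (E : {group Gamma}).

(* Conjugation by x in Gamma acts on H / K as conjugation by [coset K x]. *)
Definition factor_isog (H K : {group Gamma}) : Prop :=
  exists f : {morphism E >-> coset_of K},
    isom E (H / K) f /\ forall x, {in E, forall e, f (e ^ x) = f e ^ coset K x}%g.

Definition chief_series (cs : seq {group Gamma}) : Prop :=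
  [set: Gamma].-chief.-series 1%G cs /\ last 1%G cs = [set: Gamma]%G.

(* The i-th factor of the series 1 = cs_(-1) < cs_0 < ... is cs_i / cs_(i-1). *)
Definition num_compl_factors (cs : seq {group Gamma}) : nat :=
  #|[set i : 'I_(size cs) |
      let H := nth 1%G cs i in let K := nth 1%G (1%G :: cs) i in
      [splits [set: Gamma] / K, over H / K] && `[< factor_isog H K >]]|.

End ChiefFactors.

(* Main.v *)
Require Import Defs.
From HB Require Import structures.
From mathcomp Require Import all_boot all_order all_algebra all_fingroup
  all_solvable all_field all_character.
From mathcomp Require Import boolp classical_sets functions cardinality.
From mathcomp Require Import fsbigop finmap.

Set Implicit Arguments.
Unset Strict Implicit.
Unset Printing Implicit Defensive.

Import GroupScope GRing.Theory.

Local Open Scope ring_scope.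
Local Open Scope abelem_scope.

(** Send an epimorphism phi : G -> Gamma to rho = phi mod E, which is in
    Epi(G, B), and count each fibre.

    The homomorphisms G -> Gamma above a given rho are the maps
    g |-> f(g) s(rho(g)) with delta^1 f = - rho^* chi ([card_lifts]).  If there
    is one, they form a torsor under Z^1(G, E) ([card_twisted_cocycles]), and
    |Z^1| = |B^1| |H^1| ([card_Z1]), where B^1 = E / E^Gamma has order |E|^zeta
    because E is a simple module ([card_range_delta0]).

    The nonsurjective lifts have to be subtracted.  Let L be the image of one of
    them.  Then L E = Gamma, and L :&: E is normalised by L and by the abelian
    group E, hence normal in Gamma; by minimality it is trivial.  So phi is
    determined by rho and factors as t \o rho for a homomorphic section
    t : B -> Gamma ([nonsurjective_lifts]).  The number of these sections does
    not depend on rho: they are the lifts of the identity of B, so there are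
    c |Z^1(B, E)| of them.

    What remains is |Z^1(B, E)| = |E|^zeta q^(kappa (alpha - 1)) when E has a
    complement, which is a theorem of Gaschuetz.  Filter Z^1(Gamma, E) along a
    chief series by the groups [relZ1 K] of the cocycles that vanish on the term
    K, and let H / K be the next chief factor.
    - If H centralises E, restriction to H embeds relZ1 K / relZ1 H in
      Hom_Gamma(H / K, E).  A cocycle f with nonzero restriction identifies H / K
      with E and its zero set is a complement of H / K; conversely a complement
      and an isomorphism H / K -> E define such an f.  Composing f with
      endomorphisms of E then realises all of Hom_Gamma(H / K, E), so the index
      is |End_Gamma(E)| exactly at the complemented factors isomorphic to E, and
      1 elsewhere ([card_relZ1_step], [essential_splits], [essential_isog],
      [splits_essential]).
    - If K centralises E and H does not, then relZ1 H = 0 and every cocycle in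
      relZ1 K is principal, by averaging ([card_relZ1_last_fixed]); this happens
      once if zeta = 1 and never if zeta = 0, and contributes |E|.
    - If K does not centralise E, then relZ1 K = 0 ([card_relZ1_moved]).
    Altogether |Z^1(Gamma, E)| = |E|^zeta |End_Gamma(E)|^alpha.  The first point,
    applied to the factor E / 1, gives |Z^1(Gamma, E)| = |End_Gamma(E)| |relZ1 E|
    if E has a complement, and relZ1 E is Z^1(B, E); this is the origin of the
    exponent alpha - 1. *)

(** * Cocycles of a finite group that vanish on a normal subgroup *)

Section RelativeCocycles.
Variables (q : nat) (q_pr : prime q) (Gamma : finGroupType).
Variables (V : finLmodType 'F_q) (act : Gamma -> {linear V -> V}).
Hypothesis actM : forall x y v, act (x * y)%g v = act x (act y v).
Hypothesis act1 : forall v, act 1%g v = v.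
Hypothesis simpleV : forall W : {set V}, 0 \in W ->
  (forall u v, u \in W -> v \in W -> u + v \in W) ->
  (forall x v, v \in W -> act x v \in W) ->
  forall v, v \in W -> v != 0 -> forall u, u \in W.

Implicit Types (K H : {group Gamma}) (f g : {ffun Gamma -> V}).

Definition relZ1 (K : {set Gamma}) : {set {ffun Gamma -> V}} :=
  [set f : {ffun Gamma -> V} |
    [forall x, forall y, f (x * y)%g == f x + act x (f y)]
    && [forall x in K, f x == 0]].

Definition fixes (H : {set Gamma}) : bool :=
  [forall x in H, forall v, act x v == v].

Definition endos : {set {ffun V -> V}} :=
  [set f : {ffun V -> V} | [forall u, forall v, f (u + v) == f u + f v]
                        && [forall x, forall v, f (act x v) == act x (f v)]].

(** For a chief factor H / K this says that H / K is complemented and isomorphic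
    to V; see [essential_splits], [essential_isog] and [splits_essential]. *)
Definition essential (K H : {set Gamma}) : bool :=
  fixes H && [exists f in relZ1 K, exists x in H, f x != 0].

Lemma relZ1P (K : {set Gamma}) f :
  reflect ((forall x y, f (x * y)%g = f x + act x (f y))
           /\ {in K, forall x, f x = 0}) (f \in relZ1 K).
Proof.
rewrite inE; apply: (iffP andP) => -[fM fK]; split.
- by move=> x y; apply/eqP; move/forallP/(_ x)/forallP: fM.
- by move=> x Kx; apply/eqP; move/forall_inP: fK; apply.
- by apply/forallP => x; apply/forallP => y; rewrite fM.
- by apply/forall_inP => x /fK ->.
Qed.

Lemma endosP (f : {ffun V -> V}) :
  reflect ((forall u v, f (u + v) = f u + f v)
           /\ forall x v, f (act x v) = act x (f v)) (f \in endos).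
Proof.
rewrite inE; apply: (iffP andP) => -[fD fJ]; split.
- by move=> u v; apply/eqP; move/forallP/(_ u)/forallP: fD.
- by move=> x v; apply/eqP; move/forallP/(_ x)/forallP: fJ.
- by apply/forallP => x; apply/forallP => y; rewrite fD.
- by apply/forallP => x; apply/forallP => y; rewrite fJ.
Qed.

Lemma fixesP (H : {set Gamma}) :
  reflect {in H, forall x v, act x v = v} (fixes H).
Proof.
apply: (iffP forall_inP) => fH x Hx.
  by move=> v; apply/eqP/(forallP (fH x Hx)).
by apply/forallP => v; rewrite fH.
Qed.

Lemma fixesS (K H : {set Gamma}) : K \subset H -> fixes H -> fixes K.
Proof. by move=> /fintype.subsetP sKH /fixesP fH; apply/fixesP => x /sKH /fH. Qed.

Lemma relZ1S (K H : {set Gamma}) : K \subset H -> relZ1 H \subset relZ1 K.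
Proof.
move=> /fintype.subsetP sKH; apply/fintype.subsetP => f /relZ1P[fM fH].
by apply/relZ1P; split=> // x /sKH /fH.
Qed.

Section OneCocycle.
Variables (K : {set Gamma}) (f : {ffun Gamma -> V}).
Hypothesis fZ : f \in relZ1 K.

Lemma relZ1M x y : f (x * y)%g = f x + act x (f y).
Proof. by case/relZ1P: fZ. Qed.

Lemma relZ1_eq0 x : x \in K -> f x = 0.
Proof. by case/relZ1P: fZ => _; apply. Qed.

Lemma relZ1_1 : f 1%g = 0.
Proof. by apply: (addrI (f 1%g)); rewrite addr0 -{2}[f 1%g]act1 -relZ1M mulg1. Qed.

Lemma relZ1V x : f x^-1%g = - act x^-1%g (f x).
Proof. by apply/eqP; rewrite -addr_eq0 -relZ1M mulVg relZ1_1. Qed.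

Lemma relZ1Mr x y : f y = 0 -> f (x * y)%g = f x.
Proof. by move=> fy; rewrite relZ1M fy linear0 addr0. Qed.

(** As x h^x = h x, and h acts trivially on f x, the cocycle f is equivariant on
    a subgroup that fixes V. *)
Lemma relZ1J (H : {set Gamma}) h x :
  fixes H -> (h ^ x)%g \in H -> f (h ^ x)%g = act x^-1%g (f h).
Proof.
move=> /fixesP fixH Hhx.
have: f (x * h ^ x)%g = f (h * x)%g by rewrite -conjgC.
rewrite (relZ1M x) (relZ1M h); have -> : act h (f x) = f x.
  have -> : h = (x * h ^ x * x^-1)%g by rewrite conjgE !mulgA mulgV mul1g mulgK.
  by rewrite 2!actM (fixH _ Hhx) -actM mulgV act1.
by rewrite [f h + _]addrC => /addrI <-; rewrite -actM mulVg act1.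
Qed.

End OneCocycle.

Lemma normal_setTJ H x y : H <| [set: Gamma] -> x \in H -> (x ^ y)%g \in H.
Proof.
case/andP=> _ /fintype.subsetP/(_ y (finset.in_setT _)) nHy Hx.
by rewrite memJ_norm.
Qed.

(** The fixed vectors of a normal subgroup form a submodule of the simple module
    V. *)
Lemma fixed_eq0 H : H <| [set: Gamma] -> ~~ fixes H ->
  forall v, {in H, forall x, act x v = v} -> v = 0.
Proof.
move=> nH /fixesP nfH v vH; apply: contra_notP nfH => /eqP v0.
pose W := [set u | [forall x in H, act x u == u]].
have WP u : reflect {in H, forall x, act x u = u} (u \in W).
  by rewrite inE; apply: (iffP forall_inP) => uH x /uH => [/eqP | ->].
suff WV u : u \in W by move=> x Hx u; apply: (WP u (WV u)).
apply: (simpleV _ _ _ (v := v)) => //; last exact/WP.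
- by apply/WP => x _; rewrite linear0.
- by move=> u1 u2 /WP w1 /WP w2; apply/WP => x Hx; rewrite linearD w1 ?w2.
- move=> x u1 /WP w1; apply/WP => y Hy.
  by rewrite -actM conjgC actM w1 // normal_setTJ.
Qed.

(** The values of a cocycle that vanishes on the normal subgroup K are fixed by
    K, since f (k x) = k (f x) and f (k x) = f (x k^x) = f x. *)
Lemma relZ1_fixed K f x k : K <| [set: Gamma] -> f \in relZ1 K -> k \in K ->
  act k (f x) = f x.
Proof.
move=> nK fZ Kk; rewrite -[LHS]add0r -[in LHS](relZ1_eq0 fZ Kk) -(relZ1M fZ).
by rewrite conjgC (relZ1Mr fZ) // (relZ1_eq0 fZ) // normal_setTJ.
Qed.

Lemma ffun0_relZ1 (K : {set Gamma}) : [ffun=> 0] \in relZ1 K.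
Proof. by apply/relZ1P; split=> [x y | x _]; rewrite !ffunE // linear0 addr0. Qed.

Lemma card_relZ1_moved K : K <| [set: Gamma] -> ~~ fixes K -> #|relZ1 K| = 1%N.
Proof.
move=> nK nfK; apply/eqP/cards1P; exists [ffun=> 0]; apply/setP => f.
rewrite finset.in_set1; apply/idP/eqP => [fZ | ->]; last exact: ffun0_relZ1.
apply/ffunP => x; rewrite ffunE; apply: (fixed_eq0 nK nfK) => k.
exact: relZ1_fixed.
Qed.

Lemma card_relZ1_top : #|relZ1 [set: Gamma]| = 1%N.
Proof.
apply/eqP/cards1P; exists [ffun=> 0]; apply/setP => f.
rewrite finset.in_set1; apply/idP/eqP => [fZ | ->]; last exact: ffun0_relZ1.
by apply/ffunP => x; rewrite ffunE (relZ1_eq0 fZ) // inE.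
Qed.

(** A q-group acting on a nonzero F_q-space fixes a nonzero vector; if H fixes it
    too, then H fixes all of the simple module V. *)
Lemma pgroup_fixes H (P : {group Gamma}) : H <| [set: Gamma] -> q.-group P ->
  (forall v, {in P, forall x, act x v = v} -> {in H, forall x, act x v = v}) ->
  fixes H.
Proof.
move=> nH qP fixPH; apply: contraT => nfH.
have [v v0] : exists v : V, v != 0.
  move/fixesP: nfH => nfH; apply: contra_notP nfH => /forallNP V0 x _ v.
  have E0 u : u = 0 :> V by apply/eqP; apply: contra_notT (V0 u).
  by rewrite [LHS]E0 [RHS]E0.
have ov : #[v : V]%g = q.
  apply: nt_prime_order => //.
  rewrite FinRing.zmodXgE -scaler_nat.
  by have /andP[_ /eqP ->] := pchar_Fp q_pr; rewrite scale0r.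
have := order_dvdG (finset.in_setT v); rewrite ov /dvdn => /eqP qV.
(* Actions of finite groups are on the right, hence the inverse. *)
pose to v x := act x^-1%g v.
have toA : is_action [set: Gamma] to.
  apply: is_total_action => [u | u x y]; first by rewrite /to invg1 act1.
  by rewrite /to invMg actM.
have actsP : [acts P, on [set: V] | Action toA].
  apply/fintype.subsetP => x Px; rewrite !inE /=; apply/fintype.subsetP => u _.
  by rewrite !inE.
have := pgroup_fix_mod qP actsP; rewrite qV.
have -> : 'Fix_([set: V] | Action toA)(P) = finset.set1 0.
  apply/setP=> u; rewrite finset.in_setI finset.in_setT finset.in_set1 /=.
  apply/afixP/eqP => [uP | -> x _].
    apply: (fixed_eq0 nH nfH); apply: fixPH => x Px.
    by have := uP x^-1%g (groupVr Px); rewrite /= /to /= invgK.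
  by rewrite /= /to linear0.
by rewrite cards1 modn_small ?prime_gt1.
Qed.

Definition principal (v : V) : {ffun Gamma -> V} := [ffun x => act x v - v].

Lemma principal_relZ1 K v : fixes K -> principal v \in relZ1 K.
Proof.
move=> /fixesP fK; apply/relZ1P; split=> [x y | x Kx]; rewrite !ffunE.
  by rewrite actM linearB /= [RHS]addrC addrA subrK.
by rewrite fK // subrr.
Qed.

Lemma principal_inj H : H <| [set: Gamma] -> ~~ fixes H -> injective principal.
Proof.
move=> nH nfH u v /ffunP euv; apply/eqP; rewrite -subr_eq0; apply/eqP.
apply: (fixed_eq0 nH nfH) => x _; have := euv x; rewrite !ffunE linearB /=.
by move=> e; rewrite -[act x u](subrK u) e addrAC [_ - v - _]addrAC subrr add0r addrC.
Qed.

Lemma relZ1_add (K : {set Gamma}) f g :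
  f \in relZ1 K -> g \in relZ1 K -> [ffun x => f x + g x] \in relZ1 K.
Proof.
move=> fZ gZ; apply/relZ1P; split=> [x y | x Kx]; rewrite !ffunE.
  by rewrite (relZ1M fZ) (relZ1M gZ) linearD addrACA.
by rewrite (relZ1_eq0 fZ) // (relZ1_eq0 gZ) // addr0.
Qed.

(** If P has order prime to q, the mean v of f over P satisfies f x = v - x v on
    P, so f + principal v vanishes on P and on K, hence on H = K P; its values
    are then fixed by H, that is, zero. *)
Lemma relZ1_principal K H (P : {group Gamma}) :
  K <| [set: Gamma] -> H <| [set: Gamma] -> fixes K -> ~~ fixes H ->
  P \subset H -> H \subset (K * P)%g -> ~~ (q %| #|P|)%N ->
  relZ1 K = [set principal v | v in V].
Proof.
move=> nK nH fK nfH sPH sHKP q'P; apply/setP => f; apply/idP/imsetP; last first.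
  by case=> v _ ->; apply: principal_relZ1.
move=> fZ; pose n : 'F_q := (#|P|)%:R.
have n0 : n != 0 by rewrite -(GRing.dvdn_pcharf (pchar_Fp q_pr)).
have [v nv] : exists v, n *: v = \sum_(x in P) f x.
  by exists (n^-1 *: \sum_(x in P) f x); rewrite scalerA mulfV // scale1r.
have fP x : x \in P -> f x = v - act x v.
  move=> Px; apply: (scalerI n0); rewrite scalerBr -linearZZ nv.
  rewrite [X in _ = X - _](reindex_inj (mulgI x)) /=.
  rewrite (eq_bigl (mem P)) => [|y]; last by rewrite groupMl.
  under eq_bigr do rewrite (relZ1M fZ).
  by rewrite big_split /= linear_sum addrK sumr_const scaler_nat.
exists (- v) => //; apply/ffunP => x; rewrite ffunE.
pose g := [ffun x => f x + principal v x].
have gZK : g \in relZ1 K by apply: relZ1_add => //; apply: principal_relZ1.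
have gE y : g y = f y + (act y v - v) by rewrite !ffunE.
have gZH : g \in relZ1 H.
  apply/relZ1P; split; first exact: relZ1M gZK.
  move=> y /(fintype.subsetP sHKP)/mulsgP[k p Kk Pp ->].
  have gp : g p = 0 by rewrite gE fP // addrA subrK subrr.
  by rewrite (relZ1Mr gZK _ gp) (relZ1_eq0 gZK).
have: g x = 0.
  by apply: (fixed_eq0 nH nfH) => k Hk; exact: (@relZ1_fixed H g x k nH gZH Hk).
by rewrite gE => /eqP; rewrite addr_eq0 => /eqP ->; rewrite linearN opprB opprK addrC.
Qed.

(** H / K is a p-group, so H = K P for a Sylow p-subgroup P.  If p = q,
    then H fixes whatever P does, and so fixes V, contrary to assumption; for
    p <> q averaging over P shows that the cocycles in relZ1 K are principal. *)
Lemma card_relZ1_last_fixed K H :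
  K <| [set: Gamma] -> chief_factor [set: Gamma] K H -> solvable [set: Gamma] ->
  fixes K -> ~~ fixes H -> #|relZ1 K| = #|V|.
Proof.
move=> nK /andP[maxK nH] solG fK nfH.
have sKH : K \subset H by case/maxgroupP: maxK => /andP[/proper_sub].
have minHK : minnormal (H / K) ([set: Gamma] / K).
  by apply: chief_factor_minnormal; apply/andP.
have [|_ _ /is_abelemP[p p_pr abHK]] :=
    minnormal_solvable minHK (quotientS K (normal_sub nH)).
  exact: quotient_sol.
have [P sylP] := Sylow_exists p H; have sPH := pHall_sub sylP.
have HKP : (K * P)%g = H.
  have nKA (A : {set Gamma}) : A \subset 'N(K).
    by apply: fintype.subset_trans (normal_norm nK); apply: finset.subsetT.
  apply/eqP; rewrite finset.eqEsubset mul_subG //=.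
  have pHK : p.-group (H / K)%g by apply: abelem_pgroup abHK.
  by rewrite -quotientSK // (pHall_id (quotient_pHall (nKA P) sylP) pHK).
have [epq | npq] := eqVneq p q.
  have qP : q.-group P by rewrite -epq (pHall_pgroup sylP).
  case/negP: nfH; apply: (pgroup_fixes nH qP) => v vP x.
  rewrite -HKP => /mulsgP[k y Kk Py ->].
  by rewrite actM vP //; apply: (fixesP _ fK).
have q'P : ~~ (q %| #|P|)%N.
  apply: contra npq => qP; rewrite eq_sym.
  by have /pgroupP/(_ q q_pr qP) := pHall_pgroup sylP.
rewrite (relZ1_principal nK nH fK nfH sPH _ q'P) ?HKP //.
by rewrite card_imset //; apply: principal_inj nfH.
Qed.

(** Given one f0 in relZ1 K that induces an isomorphism of H / K onto V, every
    element of relZ1 K is uniquely p \o f0 + f with p an endomorphism of V and f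
    in relZ1 H, because its restriction to H factors through f0. *)
Section Extend.
Variables (K H : {group Gamma}) (f0 : {ffun Gamma -> V}).
Hypotheses (sKH : K \subset H) (nH : H <| [set: Gamma]) (fixH : fixes H).
Hypotheses (f0Z : f0 \in relZ1 K) (f0V : forall v, exists2 h, h \in H & f0 h = v).
Hypothesis (f0K : forall h, h \in H -> f0 h = 0 -> h \in K).

Lemma relZ1_factor g h h' : g \in relZ1 K -> h \in H -> h' \in H ->
  f0 h = f0 h' -> g h = g h'.
Proof.
move=> gZ Hh Hh' e; have Kh : (h^-1 * h')%g \in K.
  apply: f0K; first by rewrite groupM ?groupV.
  by rewrite (relZ1M f0Z) (relZ1V f0Z) e addNr.
by rewrite -(mulKVg h h') (relZ1Mr gZ) // (relZ1_eq0 gZ).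
Qed.

Definition combine (u : {ffun V -> V} * {ffun Gamma -> V}) : {ffun Gamma -> V} :=
  [ffun x => u.1 (f0 x) + u.2 x].

Lemma combine_inj : {in finset.setX endos (relZ1 H) &, injective combine}.
Proof.
move=> [p f] [p' f'] /setXP[/= _ fZ] /setXP[/= _ f'Z] /ffunP e.
have ep : p = p'.
  apply/ffunP => v; have [h Hh <-] := f0V v.
  by have := e h; rewrite !ffunE /= (relZ1_eq0 fZ) // (relZ1_eq0 f'Z) // !addr0.
rewrite -ep; congr pair; apply/ffunP => x.
by have := e x; rewrite !ffunE /= -ep => /addrI.
Qed.

Lemma combine_image : combine @: finset.setX endos (relZ1 H) = relZ1 K.
Proof.
apply/setP => g; apply/imsetP/idP => [[[p f] /setXP[/= /endosP[pD pJ] fZ] ->] | gZ].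
  have p0 : p 0 = 0 by apply: (addrI (p 0)); rewrite -pD !addr0.
  have fZK := fintype.subsetP (relZ1S sKH) _ fZ.
  apply/relZ1P; split=> [x y | x Kx]; rewrite !ffunE /=.
    by rewrite (relZ1M f0Z) (relZ1M fZ) pD pJ linearD /= addrACA.
  by rewrite (relZ1_eq0 f0Z) // p0 add0r (relZ1_eq0 fZK).
pose sec v := odflt 1%g [pick h in H | f0 h == v].
have secP v : sec v \in H /\ f0 (sec v) = v.
  rewrite /sec; case: pickP => [h /andP[Hh /eqP] // | no].
  by have [h Hh e] := f0V v; have := no h; rewrite Hh e eqxx.
have [p pE] : exists p : {ffun V -> V}, {in H, forall h, p (f0 h) = g h}.
  exists [ffun v => g (sec v)] => h Hh; rewrite ffunE.
  by have [? ?] := secP (f0 h); apply: relZ1_factor.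
have pZ : p \in endos.
  apply/endosP; split=> [u v | x v].
    have [[h Hh <-] [h' Hh' <-]] := (f0V u, f0V v).
    have fixh w : act h w = w by apply: (fixesP _ fixH).
    rewrite -{1}[f0 h']fixh -(relZ1M f0Z) !pE ?groupM //.
    by rewrite (relZ1M gZ) fixh.
  have [h Hh <-] := f0V v; have Hhx : (h ^ x^-1)%g \in H by apply: normal_setTJ.
  have := relZ1J f0Z fixH Hhx; rewrite invgK => <-.
  by rewrite !pE // (relZ1J gZ fixH Hhx) invgK.
exists (p, [ffun x => g x - p (f0 x)]); last first.
  by apply/ffunP => x; rewrite !ffunE /= addrC subrK.
apply/setXP; split=> //=; have [pD pJ] := endosP _ pZ.
apply/relZ1P; split=> [x y | x Hx]; rewrite !ffunE; last by rewrite pE // subrr.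
by rewrite (relZ1M gZ) (relZ1M f0Z) pD pJ linearB /= opprD addrACA.
Qed.

Lemma card_relZ1_extend : #|relZ1 K| = (#|endos| * #|relZ1 H|)%N.
Proof. by rewrite -combine_image card_in_imset ?cardsX //; apply: combine_inj. Qed.

End Extend.

(** The image of H under f is a nonzero submodule of the simple module V, and the
    zeros of f in H form a normal subgroup of Gamma between K and H. *)
Lemma chief_relZ1_bij K H f h :
  chief_factor [set: Gamma] K H -> fixes H -> f \in relZ1 K -> h \in H -> f h != 0 ->
  (forall v, exists2 x, x \in H & f x = v)
  /\ (forall x, x \in H -> f x = 0 -> x \in K).
Proof.
move=> /andP[/maxgroupP[/andP[prKH nKG] maxK] nH] fixH fZ Hh fh.
have fixHE := fixesP _ fixH.
have fM x y : x \in H -> f (x * y)%g = f x + f y by move=> Hx; rewrite (relZ1M fZ) fixHE.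
split=> [v | ].
  have /imsetP[x Hx ->] : v \in [set f x | x in H]; last by exists x.
  apply: (simpleV _ _ _ (v := f h)) => //; last exact: imset_f.
  - by apply/imsetP; exists 1%g; rewrite ?group1 ?(relZ1_1 fZ).
  - by move=> _ _ /imsetP[x Hx ->] /imsetP[y Hy ->]; rewrite -fM // imset_f // groupM.
  - move=> x _ /imsetP[y Hy ->].
    by rewrite -[x]invgK -(relZ1J fZ fixH) ?imset_f // normal_setTJ.
have gL : group_set [set x in H | f x == 0].
  apply/group_setP; rewrite !inE group1 (relZ1_1 fZ) eqxx; split=> // x y.
  rewrite !inE => /andP[Hx /eqP fx] /andP[Hy /eqP fy].
  by rewrite groupM // fM // fx fy addr0 eqxx.
have sKL : K \subset Group gL.
  apply/fintype.subsetP => x Kx; rewrite inE (relZ1_eq0 fZ) // eqxx andbT.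
  exact: (fintype.subsetP (proper_sub prKH)).
have prL : Group gL \proper H.
  apply/properP; split; first by apply/fintype.subsetP => x; rewrite inE => /andP[].
  by exists h; rewrite // inE negb_and fh orbT.
have nL : [set: Gamma] \subset 'N(Group gL).
  apply/fintype.subsetP => x _; rewrite inE; apply/fintype.subsetP => _ /imsetP[y + ->].
  rewrite !inE => /andP[Hy /eqP fy]; have Hyx := normal_setTJ x nH Hy.
  by rewrite Hyx (relZ1J fZ fixH) // fy linear0 eqxx.
have maxL := maxK (Group gL); rewrite prL nL in maxL.
by move=> x Hx fx; rewrite -(maxL isT sKL) inE Hx fx eqxx.
Qed.

Lemma card_relZ1_step K H : chief_factor [set: Gamma] K H -> fixes H ->
  #|relZ1 K| = (#|endos| ^ essential K H * #|relZ1 H|)%N.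
Proof.
move=> chKH fixH; have /andP[maxK nH] := chKH.
have sKH : K \subset H by case/maxgroupP: maxK => /andP[/proper_sub].
rewrite /essential fixH /=; case: exists_inP => [[f fZ /exists_inP[h Hh fh]] | no].
  have [fV fK] := chief_relZ1_bij chKH fixH fZ Hh fh.
  by rewrite (card_relZ1_extend sKH nH fixH fZ fV fK).
rewrite mul1n; congr (#|pred_of_set _|); apply/eqP.
rewrite finset.eqEsubset; apply/andP; split; last exact: relZ1S.
apply/fintype.subsetP => f fZ; apply/relZ1P; split; first exact: relZ1M fZ.
move=> h Hh; apply/eqP; apply: contra_notT no => fh.
by exists f => //; apply/exists_inP; exists h.
Qed.

Fixpoint num_essential (K : {set Gamma}) (cs : seq {group Gamma}) : nat :=
  if cs is H :: cs' then essential K H + num_essential H cs' else 0%N.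

(** Going down the series from the top, a chief factor contributes |End(V)| if it
    is essential, |V| if it is the one at which the terms cease to fix V, and 1
    otherwise. *)
Theorem card_relZ1 K (cs : seq {group Gamma}) :
  solvable [set: Gamma] -> K <| [set: Gamma] ->
  ([set: Gamma].-chief).-series K cs -> last K cs = [set: Gamma]%G ->
  #|relZ1 K| = (#|V| ^ (fixes K && ~~ fixes [set: Gamma])
                * #|endos| ^ num_essential K cs)%N.
Proof.
move=> solG; elim: cs K => [|H cs IH] K nK /=.
  by move=> _ ->; rewrite card_relZ1_top andbN.
move=> /andP[chKH chHs] lastT; have /andP[maxK nH] := chKH.
have sKH : K \subset H by case/maxgroupP: maxK => /andP[/proper_sub].
have {IH} := IH H nH chHs lastT.
have [fixH | nfH] := boolP (fixes H).
  by rewrite (card_relZ1_step chKH fixH) (fixesS sKH fixH) => ->; rewrite expnD mulnCA.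
have nfG : ~~ fixes [set: Gamma].
  by apply: contra nfH; apply: fixesS; apply: finset.subsetT.
rewrite card_relZ1_moved // mul1n => eH.
rewrite /essential (negbTE nfH) nfG add0n -eH muln1 andbT.
have [fixK | nfK] := boolP (fixes K); last by rewrite card_relZ1_moved.
by rewrite (card_relZ1_last_fixed nK chKH).
Qed.

End RelativeCocycles.
(** * A minimal normal subgroup as a simple module *)

Lemma conjg_abelian (gT : finGroupType) (A : {group gT}) x y :
  abelian A -> x \in A -> y \in A -> (x ^ y)%g = x.
Proof. by move=> /centsP cAA Ax Ay; rewrite /conjg (cAA x Ax y Ay) mulKg. Qed.

(** Projection to an abelian normal subgroup along a complement is a cocycle for
    the conjugation action. *)
Lemma divgr_cocycle (gT : finGroupType) (H M : {group gT}) x y :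
  abelian H -> H :&: M = 1%g -> (forall u v, u \in H -> (u ^ v)%g \in H) ->
  x \in (H * M)%g -> y \in (H * M)%g ->
  divgr H M (x * y)%g = (divgr H M x * divgr H M y ^ x^-1)%g.
Proof.
move=> cHH tiHM nHJ /mulsgP[a m Ha Mm ->] /mulsgP[b n Hb Mn ->].
have -> : (a * m * (b * n) = a * b ^ m^-1 * (m * n))%g.
  by rewrite conjgE invgK !mulgA mulgKV.
have HbJ := nHJ b m^-1%g Hb; rewrite (divgrMid tiHM (groupM Ha HbJ) (groupM Mm Mn)).
rewrite (divgrMid tiHM Ha Mm) (divgrMid tiHM Hb Mn); congr (a * _)%g.
by rewrite invMg conjgM [RHS](conjg_abelian cHH) // groupV.
Qed.

Section MinimalNormalModule.
Variables (q : nat) (q_pr : prime q) (Gamma : finGroupType) (E : {group Gamma}).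
Hypotheses (abelE : q.-abelem E) (minE : minnormal E [set: Gamma]).

Let toV : Gamma -> 'rV['F_q](E) := abelem_rV abelE (minnormal_neq1 minE).
Let toE : 'rV['F_q](E) -> Gamma := rVabelem abelE (minnormal_neq1 minE).

Definition conj_action (x : Gamma) : {linear 'rV['F_q](E) -> 'rV['F_q](E)} :=
  conjV abelE minE x.

Local Notation act := conj_action.

Lemma memEJ e x : e \in E -> (e ^ x)%g \in E.
Proof. by move=> Ee; rewrite memJ_norm // minnormal_norm. Qed.

Lemma toVM : {in E &, {morph toV : x y / (x * y)%g >-> x + y}}.
Proof. exact: abelem_rV_M. Qed.

Lemma toE_inE v : toE v \in E. Proof. exact: mem_rVabelem. Qed.

Lemma toVK : {in E, cancel toV toE}. Proof. exact: abelem_rV_K. Qed.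

Lemma toEK : cancel toE toV. Proof. exact: rVabelemK. Qed.

Lemma conj_actionE x v : act x v = toV (toE v ^ x^-1)%g.
Proof. by rewrite conjgE invgK mulgA. Qed.

Lemma toE_conj_action x v : toE (act x v) = (toE v ^ x^-1)%g.
Proof. by rewrite conj_actionE toVK // memEJ // toE_inE. Qed.

Lemma conj_action_toV x e : e \in E -> act x (toV e) = toV (e ^ x^-1)%g.
Proof. by move=> Ee; rewrite conj_actionE toVK. Qed.

Lemma conj_actionM x y v : act (x * y)%g v = act x (act y v).
Proof. by rewrite !conj_actionE toVK ?memEJ ?toE_inE // -conjgM invMg. Qed.

Lemma conj_action1 v : act 1%g v = v.
Proof. by rewrite conj_actionE invg1 conjg1 toEK. Qed.

Lemma minnormal_eq (A : {set Gamma}) : group_set A -> A \subset E ->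
  (forall e x, e \in A -> (e ^ x)%g \in A) -> A != 1%g -> A = E.
Proof.
move=> gA sAE nA ntA; case/mingroupP: minE => _ /(_ (Group gA)) minA.
have nL : [set: Gamma] \subset 'N(Group gA).
  apply/fintype.subsetP => x _; rewrite inE.
  by apply/fintype.subsetP => _ /imsetP[e Ae ->]; apply: nA.
have {}ntA : Group gA != 1%g :> {set Gamma} by exact: ntA.
by rewrite ntA nL in minA; rewrite -[RHS](minA isT sAE).
Qed.

Lemma conj_action_simple (W : {set 'rV['F_q](E)}) : 0 \in W ->
  (forall u v, u \in W -> v \in W -> u + v \in W) ->
  (forall x v, v \in W -> act x v \in W) ->
  forall v, v \in W -> v != 0 -> forall u, u \in W.
Proof.
move=> W0 WD WJ v Wv v0 u.
have gL : group_set [set e in E | toV e \in W].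
  apply/group_setP; split; first by rewrite inE group1 /toV abelem_rV_1.
  move=> x y; rewrite !inE => /andP[Ex Wx] /andP[Ey Wy].
  by rewrite groupM // toVM // WD.
have eLE : [set e in E | toV e \in W] = E.
  apply: minnormal_eq => //.
  - by apply/fintype.subsetP => e; rewrite inE => /andP[].
  - move=> e x; rewrite !inE => /andP[Ee We].
    by rewrite memEJ // -[x]invgK -conj_action_toV // WJ.
  apply/(@trivgPn _ (Group gL)); exists (toE v); first by rewrite inE toE_inE toEK.
  by apply: contra v0 => /eqP e; rewrite -[v]toEK e /toV abelem_rV_1.
by have /setP/(_ (toE u)) := eLE; rewrite inE toE_inE toEK.
Qed.

Lemma minnormal_normal : E <| [set: Gamma].
Proof.
rewrite /normal finset.subsetT.
by apply/fintype.subsetP => x _; apply: minnormal_norm.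
Qed.

Lemma fixes_conj_action : fixes act E.
Proof.
apply/fixesP => x Ex v; rewrite conj_actionE.
by rewrite (conjg_abelian (abelem_abelian abelE)) ?toE_inE ?groupV ?toEK.
Qed.

Lemma normal_cosetT (K : {group Gamma}) x : K <| [set: Gamma] -> x \in 'N(K).
Proof. by move/normal_norm/fintype.subsetP; apply; rewrite inE. Qed.

(** The complement is the zero set of f, which meets H in K; it is a supplement
    because f takes all its values already on H. *)
Lemma essential_splits (K H : {group Gamma}) :
  K <| [set: Gamma] -> chief_factor [set: Gamma] K H ->
  essential act K H -> [splits [set: Gamma] / K, over H / K].
Proof.
move=> nK chKH /andP[fixH /exists_inP[f fZ /exists_inP[h Hh fh]]].
have [fV fK] := chief_relZ1_bij conj_actionM conj_action1 conj_action_simple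
  chKH fixH fZ Hh fh.
have /andP[/maxgroupP[/andP[/proper_sub sKH _] _] nH] := chKH.
have f1 := relZ1_1 conj_action1 fZ.
have gM : group_set [set x | f x == 0].
  apply/group_setP; rewrite inE f1 eqxx; split=> // x y.
  by rewrite !inE => /eqP fx /eqP fy; rewrite (relZ1Mr fZ) // fx.
have sKM : K \subset Group gM.
  by apply/fintype.subsetP => x Kx; rewrite inE (relZ1_eq0 fZ).
apply/splitsP; exists (Group gM / K)%G; apply/complP; split.
  rewrite -quotientGI //; apply: quotientS1.
  by apply/fintype.subsetP => x; rewrite !inE => /andP[Hx /eqP/fK->].
rewrite -quotientMl; last by apply/fintype.subsetP => x _; apply: normal_cosetT.
have -> // : (H * Group gM)%g = [set: Gamma].
apply/eqP; rewrite finset.eqEsubset finset.subsetT.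
apply/fintype.subsetP => x _; have [y Hy fy] := fV (f x).
rewrite -(mulKVg y x); apply: mem_mulg => //; rewrite inE.
rewrite (relZ1M fZ) (relZ1V conj_action1 fZ) fy -fy.
by rewrite addNr.
Qed.

(** The isomorphism inverts the one from H / K to E that f induces. *)
Lemma essential_isog (K H : {group Gamma}) :
  K <| [set: Gamma] -> chief_factor [set: Gamma] K H ->
  essential act K H -> factor_isog E H K.
Proof.
move=> nK chKH /andP[fixH /exists_inP[f fZ /exists_inP[h Hh fh]]].
have [fV fK] := chief_relZ1_bij conj_actionM conj_action1 conj_action_simple
  chKH fixH fZ Hh fh.
have /andP[_ nH] := chKH.
(* The default is never reached, as f maps H onto the module. *)
pose sec v := odflt 1%g [pick h in H | f h == v].
have secP v : sec v \in H /\ f (sec v) = v.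
  rewrite /sec; case: pickP => [x /andP[Hx /eqP] // | no].
  by have [x Hx e] := fV v; have := no x; rewrite Hx e eqxx.
pose phi e := coset K (sec (toV e)).
have fH x y : x \in H -> f (x * y)%g = f x + f y.
  by move=> Hx; rewrite (relZ1M fZ) (fixesP _ _ fixH).
have phiE e x : x \in H -> f x = toV e -> phi e = coset K x.
  move=> Hx fx; have [Hs fs] := secP (toV e).
  apply/rcoset_kercosetP; rewrite ?normal_cosetT // mem_rcoset.
  apply: fK; first by rewrite groupM ?groupV.
  by rewrite fH // (relZ1V conj_action1 fZ) (fixesP _ _ fixH) ?groupV // fx fs subrr.
have phiM : {in E &, {morph phi : x y / (x * y)%g}}.
  move=> x y Ex Ey; have [[Hx fx] [Hy fy]] := (secP (toV x), secP (toV y)).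
  rewrite (phiE (x * y)%g (sec (toV x) * sec (toV y))%g) ?groupM //.
    by rewrite morphM ?normal_cosetT.
  by rewrite fH // fx fy toVM.
exists (Morphism phiM); split.
  apply/isomP; split.
    apply/injmP => x y Ex Ey /= exy.
    have [[Hx fx] [Hy fy]] := (secP (toV x), secP (toV y)).
    rewrite -(toVK Ex) -(toVK Ey) -fx -fy; congr toE.
    move/rcoset_kercosetP: exy; rewrite !normal_cosetT // => /(_ isT isT).
    rewrite mem_rcoset => Kxy; have := relZ1_eq0 fZ Kxy.
    rewrite fH // (relZ1V conj_action1 fZ) (fixesP _ _ fixH) ?groupV //.
    by move/eqP; rewrite subr_eq0 => /eqP.
  apply/setP => u; apply/morphimP/idP => [[e _ Ee ->] | ].
    by rewrite mem_quotient //; have [] := secP (toV e).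
  case/morphimP => x nx Hx ->; exists (toE (f x)); rewrite ?toE_inE //.
  by rewrite /= (phiE _ x) // toEK.
move=> x e Ee /=; have [He fe] := secP (toV e).
rewrite (phiE _ (sec (toV e) ^ x)%g) ?normal_setTJ //.
  by rewrite morphJ ?normal_cosetT.
rewrite (relZ1J conj_actionM conj_action1 fZ fixH) ?normal_setTJ //.
by rewrite fe conj_action_toV // invgK.
Qed.

(** The cocycle is the projection of Gamma / K to H / K along the complement,
    followed by the given isomorphism from H / K to E. *)
Lemma splits_essential (K H : {group Gamma}) :
  K <| [set: Gamma] -> H <| [set: Gamma] ->
  [splits [set: Gamma] / K, over H / K] -> factor_isog E H K ->
  essential act K H.
Proof.
move=> nK nH /splitsP[M /complP[tiHM defG]].
move=> [phi [/isomP[injphi imphi] phiJ]].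
have cHH : abelian (H / K)%g by rewrite -imphi morphim_abelian // (abelem_abelian abelE).
have phiH e : e \in E -> phi e \in (H / K)%g by move=> Ee; rewrite -imphi mem_morphim.
have NK x : x \in 'N(K) by apply: normal_cosetT.
have inG (b : Gamma) : coset K b \in (H / K * M)%g.
  by rewrite defG mem_quotient // inE.
pose d x := divgr (H / K)%g M (coset K x).
have dH x : d x \in (H / K)%g by apply: mem_divgr; apply: inG.
have [lift liftP] : exists lift : Gamma -> Gamma,
    forall x, lift x \in E /\ phi (lift x) = d x.
  have ex x : exists e, (e \in E) && (phi e == d x).
    have := dH x; rewrite -imphi => /morphimP[e _ Ee ->].
    by exists e; rewrite Ee eqxx.
  exists (fun x => xchoose (ex x)) => x.
  by have /andP[? /eqP ?] := xchooseP (ex x).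
have phi_inj := injmP injphi.
have liftE x e : e \in E -> d x = phi e -> lift x = e.
  by move=> Ee dx; have [El le] := liftP x; apply: phi_inj; rewrite // le.
have dM x y : d (x * y)%g = (d x * d y ^ (coset K x)^-1)%g.
  rewrite /d morphM ?normal_cosetT //; 
  apply: (divgr_cocycle cHH tiHM _ (inG x) (inG y)) => u v.
  case/morphimP => h _ Hh ->; rewrite -[v]coset_reprK -morphJ ?normal_cosetT //.
  by rewrite mem_quotient // normal_setTJ.
pose f : {ffun Gamma -> 'rV['F_q](E)} := [ffun x => toV (lift x)].
have fZ : f \in relZ1 act K.
  apply/relZ1P; split=> [x y | x Kx]; rewrite !ffunE.
    have [[Ex ex] [Ey ey]] := (liftP x, liftP y).
    rewrite conj_action_toV // -toVM ?memEJ //; congr toV.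
    have Eyx : (lift y ^ x^-1)%g \in E by apply: memEJ.
    apply: liftE; first exact: groupM.
    by rewrite dM (morphM phi Ex Eyx) phiJ // ex ey morphV ?normal_cosetT.
  rewrite (liftE x 1%g) // ?morph1 /toV ?abelem_rV_1 //.
  by rewrite /d (coset_id Kx) divgr_id.
have fixH : fixes act H.
  apply/fixesP => x Hx v; rewrite conj_actionE -[RHS]toEK; congr toV.
  apply: phi_inj; rewrite ?memEJ ?toE_inE // phiJ ?toE_inE //.
  by rewrite (conjg_abelian cHH) ?phiH ?toE_inE // mem_quotient // groupV.
rewrite /essential fixH; apply/exists_inP; exists f => //.
have [e Ee e1] := trivgPn _ (minnormal_neq1 minE).
have := phiH e Ee; case/morphimP => x _ Hx ex.
apply/exists_inP; exists x => //; rewrite ffunE (liftE x e) //.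
  by rewrite -(toVK Ee) in e1; apply: contra e1 => /eqP ->; rewrite /toE rVabelem0.
by rewrite /d -ex divgr_id // phiH.
Qed.
End MinimalNormalModule.
(** * The first cohomology of Gamma and the complemented chief factors *)

Section ChiefFactorCount.
Variables (q : nat) (q_pr : prime q) (Gamma : finGroupType) (E : {group Gamma}).
Hypotheses (abelE : q.-abelem E) (minE : minnormal E [set: Gamma]).
Hypothesis Gamma_sol : solvable [set: Gamma].

Local Notation act := (conj_action abelE minE).
Let toV : Gamma -> 'rV['F_q](E) := abelem_rV abelE (minnormal_neq1 minE).

Lemma num_essentialE (K : {group Gamma}) (cs : seq {group Gamma}) :
  K <| [set: Gamma] -> ([set: Gamma].-chief).-series K cs ->
  num_essential act K cs =
  #|[set i : 'I_(size cs) |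
      let H := nth 1%G cs i in let K := nth 1%G (K :: cs) i in
      [splits [set: Gamma] / K, over H / K] && `[< factor_isog E H K >]]|.
Proof.
rewrite cardsE -sum1_card big_mkcond /=.
elim: cs K => [|H cs IH] K nK /=; first by rewrite big_ord0.
move=> /andP[chKH chHs]; have /andP[_ nH] := chKH.
rewrite big_ord_recl /= (IH H) //; congr (_ + _)%N.
have -> : essential act K H =
    [splits [set: Gamma] / K, over H / K] && `[< factor_isog E H K >].
  apply/idP/andP => [ess | [spl /asboolP iso]]; last exact: splits_essential.
  by split; [exact: essential_splits ess | apply/asboolP; exact: essential_isog ess].
by rewrite unfold_in /=; case: (_ && _).
Qed.

Lemma card_relZ1_1 (cs : seq {group Gamma}) : chief_series cs ->
  #|relZ1 act 1%g| = (#|E| ^ (~~ fixes act [set: Gamma])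
                      * #|EndGamma abelE minE| ^ num_compl_factors E cs)%N.
Proof.
case=> chs lastT; have n1 : 1%G <| [set: Gamma] by apply: normal1.
rewrite (card_relZ1 q_pr (conj_actionM abelE minE) (conj_action1 abelE minE)
  (@conj_action_simple _ _ _ abelE minE) Gamma_sol n1 chs lastT).
have -> : fixes act 1%G.
  by apply/fixesP => x /set1P -> v; rewrite conj_action1.
rewrite (num_essentialE n1 chs); congr (_ ^ _ * _)%N.
exact: card_abelem_rV abelE (minnormal_neq1 minE).
Qed.

(** The hypothesis on f says that E has a complement, namely the zero set of f;
    the chief factor E / 1 then contributes one factor |End|. *)
Lemma card_relZ1_complement (f : {ffun Gamma -> 'rV['F_q](E)}) :
  f \in relZ1 act 1%g -> {in E, f =1 toV} ->
  #|relZ1 act 1%g| = (#|EndGamma abelE minE| * #|relZ1 act E|)%N.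
Proof.
move=> fZ fE.
apply: (card_relZ1_extend (conj_actionM abelE minE) (conj_action1 abelE minE)
  (sub1G E) (minnormal_normal minE) (fixes_conj_action abelE minE) fZ) => [v | e Ee].
  have Ev := mem_rVabelem abelE (minnormal_neq1 minE) v.
  by exists (rVabelem abelE (minnormal_neq1 minE) v); rewrite ?fE //; apply: rVabelemK.
rewrite fE // => e0; apply/set1P.
by rewrite -(abelem_rV_K abelE (minnormal_neq1 minE) Ee) [abelem_rV _ _ _]e0 rVabelem0.
Qed.

Lemma card_relZ1_E (cs : seq {group Gamma}) kappa f : chief_series cs ->
  f \in relZ1 act 1%g -> {in E, f =1 toV} ->
  (q ^ kappa)%N = #|EndGamma abelE minE| ->
  (#|relZ1 act E|)%:R = (#|E| ^ (~~ fixes act [set: Gamma]))%:R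
    * (q%:R : rat) ^ (kappa%:Z * ((num_compl_factors E cs)%:Z - 1)) :> rat.
Proof.
move=> csP fZ fE kE.
have q0 : (q%:R : rat) != 0 by rewrite Num.Theory.pnatr_eq0 -lt0n prime_gt0.
have := card_relZ1_1 csP; rewrite (card_relZ1_complement fZ fE) -kE => e.
have qk0 : (q%:R ^+ kappa : rat) != 0 by rewrite expf_neq0.
apply: (mulfI qk0); rewrite -natrX -natrM e natrM mulrCA; congr (_ * _).
rewrite -expnM !natrX !exprnP -(expfzDr _ _ q0).
have -> : kappa%:Z + kappa%:Z * ((num_compl_factors E cs)%:Z - 1)
  = (kappa * num_compl_factors E cs)%N%:Z.
  by rewrite mulrBr mulr1 addrC subrK PoszM.
by [].
Qed.

End ChiefFactorCount.
(** * Cardinals of finite modules and of H^1 *)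

Lemma card_eq_fset_set (T U : choiceType) (A : set T) (B : set U) :
  (A #= B)%card -> #|` fset_set A| = #|` fset_set B|.
Proof.
move=> AB; have [[n An]|infA] := pselect (finite_set A).
  by rewrite (card_fset_set An) (card_fset_set (card_eq_trans (card_esym AB) An)).
have infB : ~ finite_set B by rewrite -(eq_finite_set AB).
by rewrite /fset_set; case: pselect => // _; case: pselect.
Qed.

Lemma card_fset_set_finset (T : finType) (A : {set T}) :
  #|` fset_set [set` A]%classic| = #|A|.
Proof.
rewrite cardE; apply/perm_size/uniq_perm; rewrite ?enum_uniq ?fset_uniq // => x.
by rewrite mem_enum in_fset_set ?mem_setE //; apply: finite_finset.
Qed.

Lemma card_fset_set_setT (T : finType) : #|` fset_set [set: T]%classic| = #|T|.
Proof.
rewrite -cardsT -card_fset_set_finset; congr (#|` fset_set _|).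
by apply/seteqP; split=> // x _ /=; rewrite inE.
Qed.

Lemma card_fibers (T U : choiceType) (h : T -> U) (A : set T) (B : set U) :
  finite_set A -> finite_set B -> (forall x, A x -> B (h x)) ->
  #|` fset_set A| =
  (\sum_(u <- fset_set B) #|` fset_set (A `&` h @^-1` [set u])%classic|)%N.
Proof.
move=> finA finB hAB.
have -> : #|` fset_set A| = (\sum_(x <- fset_set A) \sum_(u <- fset_set B) (h x == u))%N.
  rewrite -sum1_size big_seq [RHS]big_seq; apply: eq_bigr => x.
  rewrite in_fset_set // => /set_mem/hAB/mem_set Bhx.
  rewrite (bigD1_seq (h x)) ?fset_uniq ?in_fset_set //= eqxx.
  by rewrite big1 // => u; rewrite eq_sym => /negbTE ->.
rewrite exchange_big; apply: eq_bigr => u _.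
rewrite -big_mkcond sum1_count -size_filter; apply/perm_size/uniq_perm.
- by rewrite filter_uniq ?fset_uniq.
- exact: fset_uniq.
move=> x; have finF : finite_set (A `&` h @^-1` [set u])%classic by apply: finite_setIl.
rewrite mem_filter !in_fset_set //; 
apply/andP/idP => [[/eqP hx /set_mem Ax] | /set_mem[Ax hx]].
  exact: mem_set.
by split; [apply/eqP | apply: mem_set].
Qed.

Section FiniteModules.
Variables (q : nat) (q_pr : prime q).

(** Take n maximal such that F_q^n embeds in M.  A vector outside the image would
    extend the embedding to F_q^(n+1). *)
Lemma vector_axiom_finite (M : lmodType 'F_q) : finite_set [set: M]%classic ->
  exists n, inhabited (Vector.axiom n M).
Proof.
move=> finM.
pose P n := `[< exists u : {linear 'rV['F_q]_n -> M}, injective u >].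
have card_le n : P n -> (q ^ n <= #|` fset_set [set: M]%classic|)%N.
  move=> /asboolP[u inju].
  have := card_mx 'F_q 1 n; rewrite (card_Fp q_pr) mul1n => <-.
  rewrite -card_fset_set_setT.
  have := inj_card_eq (A := [set: 'rV['F_q]_n]%classic) (in2W inju).
  move=> /card_eq_fset_set <-.
  by apply: fsubset_leq_card; rewrite -fset_set_sub //; exact: sub_finite_set finM.
have P0 : exists n, P n.
  exists 0%N; apply/asboolP; exists (\0%R : {linear 'rV['F_q]_0 -> M}) => u v _.
  by rewrite [u]thinmx0 [v]thinmx0.
have Pub n : P n -> (n <= #|` fset_set [set: M]%classic|)%N.
  by move/card_le; apply: leq_trans; apply/ltnW/ltn_expl/prime_gt1.
case: (ex_maxnP P0 Pub) => n /asboolP[u inju] maxn; exists n.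
have [surju | nsurj] := pselect (forall m, exists r, u r = m).
  have [v vK] := choice surju; have uK : cancel u v by move=> r; apply: inju.
  constructor; exists v; last by exists u.
  by move=> a m m'; apply: inju; rewrite linearP !vK.
have [m mP] : exists m, forall r, u r <> m.
  by move/existsNP: nsurj => [m /forallNP mP]; exists m.
pose w (r : 'rV['F_q]_(1 + n)) := (lsubmx r) 0 0 *: m + u (rsubmx r).
have w_lin : linear w.
  move=> a r r'; rewrite /w.
  have -> : lsubmx (a *: r + r') 0 0 = a * lsubmx r 0 0 + lsubmx r' 0 0 by rewrite !mxE.
  have -> : rsubmx (a *: r + r') = a *: rsubmx r + rsubmx r' by rewrite linearP.
  by rewrite linearP scalerDl scalerDr scalerA addrACA.
pose wl : {linear 'rV['F_q]_(1 + n) -> M} :=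
  HB.pack w (GRing.isLinear.Build _ _ _ _ w w_lin).
suff /maxn : P (1 + n)%N by rewrite ltnn.
apply/asboolP; exists wl; apply: raddf_inj => r.
change (w r = 0 -> r = 0); rewrite /w; set a := lsubmx r 0 0 => e.
have a0 : a = 0.
  apply/eqP; apply: contra_notT (mP (- a^-1 *: rsubmx r)) => a0.
  rewrite linearZ /= scaleNr -scalerN.
  have -> : - u (rsubmx r) = a *: m by apply/eqP; rewrite eq_sym -addr_eq0 e.
  by rewrite scalerA mulVf // scale1r.
move: e; rewrite a0 scale0r add0r => /eqP; rewrite raddf_eq0 // => /eqP rr.
have lr : lsubmx r = 0 by apply/rowP => i; rewrite [i]ord1 [LHS]a0 mxE.
by rewrite -[r]hsubmxK lr rr row_mx0.
Qed.

Lemma card_lmod_dim (M : lmodType 'F_q) : finite_set [set: M]%classic ->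
  #|` fset_set [set: M]%classic| = (q ^ lmod_dim M)%N.
Proof.
move=> finM; rewrite /lmod_dim; case: xgetP => [n _ [[v _ bijv]] | no].
  have := card_mx 'F_q 1 n; rewrite (card_Fp q_pr) mul1n => <-.
  rewrite -card_fset_set_setT; apply: card_eq_fset_set.
  apply: card_esym; have -> : [set: 'rV['F_q]_n]%classic = (v @` [set: M])%classic.
    case: bijv => v' _ vK; apply/seteqP; split=> // r _.
    by exists (v' r).
  exact: inj_card_eq (in2W (bij_inj bijv)).
by have [n axn] := vector_axiom_finite finM; case: (no n).
Qed.

End FiniteModules.

Section CohomologyCount.
Variables (q : nat) (q_pr : prime q) (G : groupType) (V : lmodType 'F_q).
Variable act : G -> {linear V -> V}.
Hypothesis actM : forall g h v, act (g * h)%g v = act g (act h v).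

Definition Z1set : set (G -> V) := [set f | f \in Z1 act]%classic.

Lemma Z1P f : f \in Z1 act <-> forall g h, f (g * h)%g = f g + act g (f h).
Proof.
split=> [/asboolP df g h | fM].
  have /(congr1 (@^~ h)) := congr1 (@^~ g) df; rewrite /delta1 => /eqP.
  by rewrite addrAC subr_eq0 addrC => /eqP.
apply/asboolP/funext => g; apply/funext => h; rewrite /delta1 fM.
by rewrite addrC addrA subrr.
Qed.

Lemma delta0_Z1 v : delta0 act v \in Z1 act.
Proof.
apply/Z1P => g h; rewrite /delta0 actM linearB.
by rewrite [RHS]addrC addrA subrK.
Qed.

Lemma card_Z1 : finite_set Z1set ->
  #|` fset_set Z1set|
  = (#|` fset_set (range (delta0 act))| * q ^ lmod_dim (H1 act))%N.
Proof.
move=> finZ.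
have finB : finite_set (range (delta0 act)).
  by apply: sub_finite_set finZ => _ [v _ <-]; apply: delta0_Z1.
have finC : finite_set [set: cocycle1 act]%classic.
  rewrite -(eq_finite_set (inj_card_eq (in2W (@val_inj _ _ (cocycle1 act))))).
  by apply: sub_finite_set finZ => _ [z _ <-]; apply: (valP z).
have finH : finite_set [set: H1 act]%classic.
  have -> : [set: H1 act]%classic = range (\pi_(H1 act)%qT : cocycle1 act -> H1 act).
    apply/seteqP; split=> // x _.
    by exists (generic_quotient.repr x) => //; rewrite reprK.
  exact: finite_image.
have <- : #|` fset_set [set: cocycle1 act]%classic| = #|` fset_set Z1set|.
  have -> : Z1set = range (val : cocycle1 act -> G -> V).
    apply/seteqP; split=> [f Zf | _ [z _ <-]]; last exact: (valP z).
    by exists (Sub f Zf) => //; apply: SubK.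
  by apply/card_eq_fset_set/card_esym/inj_card_eq => x y _ _; apply: val_inj.
rewrite (card_fibers (h := \pi_(H1 act)%qT) finC finH) // -(card_lmod_dim q_pr finH).
(* Every fibre of Z^1 -> H^1 is a coset of the group of principal cocycles. *)
rewrite (eq_bigr (fun=> #|` fset_set (range (delta0 act))|)) => [|x _]; last first.
  pose z0 := generic_quotient.repr x.
  have z0x : \pi_(H1 act)%qT z0 = x by apply: reprK.
  have -> : range (delta0 act) = ((fun z : cocycle1 act => val (z - z0)) @`
      ([set: cocycle1 act] `&` \pi_(H1 act)%qT @^-1` [set x]))%classic.
    apply/seteqP; split=> [_ [v _ <-] | _ [z [_ /= zx] <-]].
      pose b : cocycle1 act := Sub (delta0 act v) (delta0_Z1 v).
      exists (z0 + b); last by rewrite addrAC subrr add0r.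
      split=> //=; rewrite -z0x; apply/eqP; rewrite piE Quotient.equivE.
      rewrite addrAC subrr add0r.
      by apply/asboolP; exists v.
    have : \pi_(H1 act)%qT z = \pi_(H1 act)%qT z0 by rewrite z0x.
    move/eqP; rewrite piE Quotient.equivE => /asboolP[v zv].
    by exists v => //; apply: esym zv.
  apply/esym/card_eq_fset_set/inj_card_eq => z z' _ _ /val_inj.
  exact: addIr.
by rewrite big_const_seq count_predT iter_addn_0.
Qed.

End CohomologyCount.
(** * Lifts of a homomorphism through the quotient by E *)

Section Morphisms.
Variables (G H : groupType) (f : G -> H).
Hypothesis fM : {morph f : x y / (x * y)%g}.

Lemma morph_grp1 : f 1%g = 1%g.
Proof. by apply: (mulgI (f 1%g)); rewrite -fM !mulg1. Qed.

Lemma morph_grpV x : f x^-1%g = (f x)^-1%g.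
Proof. by apply: (mulgI (f x)); rewrite -fM !mulgV morph_grp1. Qed.

End Morphisms.

Section Lifts.
Variables (q : nat) (q_pr : prime q) (Gamma : finGroupType) (E : {group Gamma}).
Hypotheses (abelE : q.-abelem E) (minE : minnormal E [set: Gamma]).
Variables (s : coset_of E -> Gamma) (sK : cancel s (coset E)).

Local Notation V := 'rV['F_q](E).
Local Notation act := (conj_action abelE minE).
Local Notation sigma := (monodromy abelE minE s).
Local Notation chi := (ext_cocycle abelE minE s).
Local Notation toV := (abelem_rV abelE (minnormal_neq1 minE)).
Local Notation toE := (rVabelem abelE (minnormal_neq1 minE)).

Lemma cosetM x y : coset E (x * y)%g = (coset E x * coset E y)%g.
Proof. by rewrite morphM // (normal_cosetT _ (minnormal_normal minE)). Qed.

Lemma coset_eqP x y : coset E x = coset E y -> exists2 e, e \in E & x = (e * y)%g.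
Proof.
have nE z := normal_cosetT z (minnormal_normal minE).
by move/rcoset_kercosetP => /(_ (nE x) (nE y)) /rcosetP.
Qed.

Lemma coset_mulE e x : e \in E -> coset E (e * x)%g = coset E x.
Proof. by move=> Ee; rewrite cosetM (coset_id Ee) mul1g. Qed.

Lemma monodromy_coset x v : sigma (coset E x) v = act x v.
Proof.
have [e Ee es] := coset_eqP (sK (coset E x)).
have -> : sigma (coset E x) v = act (e * x)%g v by rewrite -es.
rewrite conj_actionM.
exact: (fixesP _ _ (fixes_conj_action abelE minE)).
Qed.

Lemma monodromyM b c v : sigma (b * c)%g v = sigma b (sigma c v).
Proof. by rewrite -{1}(sK b) -{1}(sK c) -cosetM monodromy_coset conj_actionM. Qed.

Lemma acts_triviallyE : acts_trivially abelE minE s = fixes act [set: Gamma].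
Proof.
apply/idP/fixesP => [/forallP tr x _ v | fixG].
  by rewrite -monodromy_coset; apply/eqP/(forallP (tr _)).
by apply/forallP => b; apply/forallP => v; apply/eqP; apply: fixG; rewrite inE.
Qed.

Lemma toE_ext_cocycle b c : toE (chi b c) = (s b * s c * (s (b * c))^-1)%g.
Proof.
apply: abelem_rV_K.
have [e Ee ->] : exists2 e, e \in E & (s b * s c)%g = (e * s (b * c))%g.
  by apply: coset_eqP; rewrite cosetM !sK.
by rewrite mulgK.
Qed.

Section Source.
Variables (G : groupType) (rho : G -> coset_of E).
Hypothesis rhoM : {morph rho : x y / (x * y)%g}.

Definition lifts : set (G -> Gamma) :=
  [set phi : G -> Gamma | {morph phi : x y / (x * y)%g}
                          /\ forall g, coset E (phi g) = rho g]%classic.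

(** The lifts of rho are g |-> f(g) s(rho(g)) for these f; see [card_lifts]. *)
Definition twisted_cocycles : set (G -> V) :=
  [set f | delta1 (sigma \o rho) f = fun g h => - chi (rho g) (rho h)]%classic.

Lemma twisted_cocycleP f : twisted_cocycles f <->
  forall g h, f (g * h)%g = f g + sigma (rho g) (f h) + chi (rho g) (rho h).
Proof.
split=> [df g h | fM].
  have /(congr1 (@^~ h)) := congr1 (@^~ g) df; rewrite /delta1 /= => /eqP.
  by rewrite addrAC subr_eq => /eqP e; rewrite [f g + _]addrC e addrC addNKr.
apply/funext => g; apply/funext => h; rewrite /delta1 /= fM.
by rewrite addrAC [X in X - _]addrC opprD addrA subrr add0r.
Qed.

Lemma card_lifts : (lifts #= twisted_cocycles)%card.
Proof.
pose F (f : G -> V) g := (toE (f g) * s (rho g))%g.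
have FM f : twisted_cocycles f <-> {morph F f : x y / (x * y)%g}.
  have e g h : (F f g * F f h)%g
    = (toE (f g + sigma (rho g) (f h) + chi (rho g) (rho h)) * s (rho (g * h)))%g.
    rewrite !rVabelemD toE_ext_cocycle [toE (sigma _ _)]toE_conj_action.
    by rewrite rhoM /F conjgE invgK !mulgA !mulgKV.
  rewrite twisted_cocycleP; split=> fM g h; first by rewrite e /F fM.
  by have := fM g h; rewrite e /F => /mulIg/rVabelem_inj.
have -> : lifts = (F @` twisted_cocycles)%classic.
  apply/seteqP; split=> [phi [phiM phiE] | _ [f /FM fM <-]]; last first.
    split=> // g; rewrite coset_mulE ?sK //; exact: mem_rVabelem.
  pose f g := toV (phi g * (s (rho g))^-1)%g.
  have FE : F f = phi.
    apply/funext => g; rewrite /F /f.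
    have [e Ee ->] : exists2 e, e \in E & phi g = (e * s (rho g))%g.
      by apply: coset_eqP; rewrite phiE sK.
    by rewrite mulgK abelem_rV_K.
  by exists f => //; apply/FM; rewrite FE.
apply: inj_card_eq => f f' _ _ /(congr1 (fun h g => toV (h g * (s (rho g))^-1)%g)).
have e f1 : (fun g => toV (F f1 g * (s (rho g))^-1)%g) = f1.
  by apply/funext => g; rewrite mulgK rVabelemK.
by rewrite !e.
Qed.

Lemma card_twisted_cocycles f0 : twisted_cocycles f0 ->
  (twisted_cocycles #= Z1set (sigma \o rho))%card.
Proof.
move=> /twisted_cocycleP f0M.
have -> : twisted_cocycles
    = ((fun f => f + f0) @` Z1set (sigma \o rho))%classic.
  apply/seteqP; split=> [f /twisted_cocycleP fM | _ [f /Z1P fM <-]].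
    exists (f - f0); last by rewrite subrK.
    have subE g : (f - f0) g = f g - f0 g by [].
    apply/Z1P => g h; rewrite !subE fM f0M linearB /=.
    by rewrite opprD addrACA subrr addr0 opprD addrACA.
  apply/twisted_cocycleP => g h.
  have addE k : (f + f0) k = f k + f0 k by [].
  by rewrite !addE fM f0M linearD /= addrA addrACA.
by apply: inj_card_eq => f f' _ _ /addIr.
Qed.

(** The map v |-> delta^0 v is zero if E is central and injective otherwise. *)
Lemma card_range_delta0 : range rho = setT ->
  #|` fset_set (range (delta0 (sigma \o rho)))|
  = (#|E| ^ (~~ fixes act [set: Gamma]))%N.
Proof.
move=> surj.
have dE v g x : rho g = coset E x -> delta0 (sigma \o rho) v g = act x v - v.
  by move=> e; rewrite /delta0 /= e monodromy_coset.
have [fixG | nfG] := boolP (fixes act [set: Gamma]).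
  have -> : range (delta0 (sigma \o rho)) = [set fun=> 0]%classic.
    have d0 v : delta0 (sigma \o rho) v = fun=> 0.
      apply/funext => g; rewrite (dE v g (s (rho g))) ?sK //.
      by rewrite (fixesP _ _ fixG) ?inE ?subrr.
    by apply/seteqP; split=> [_ [v _ <-] | _ ->]; [| exists 0].
  by rewrite fset_set1 cardfs1.
rewrite -(card_abelem_rV abelE (minnormal_neq1 minE)) -card_fset_set_setT.
apply/card_eq_fset_set/inj_card_eq => u v _ _ e.
refine (principal_inj (conj_actionM abelE minE) (@conj_action_simple _ _ _ abelE minE)
  (normal_refl [set: Gamma]) nfG _).
apply/ffunP => x; rewrite !ffunE.
have : range rho (coset E x) by rewrite surj.
by case=> g _ gx; rewrite -!(dE _ _ _ gx) e.
Qed.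

End Source.

(** Inflation: a cocycle of Gamma that vanishes on E is constant on the cosets of
    E. *)
Lemma card_Z1_quotient : (Z1set sigma #= [set` relZ1 act E])%card.
Proof.
pose F (f : coset_of E -> V) : {ffun Gamma -> V} := [ffun x => f (coset E x)].
apply: card_esym.
have -> : [set` relZ1 act E]%classic = (F @` Z1set sigma)%classic.
  apply/seteqP; split=> [f /= fZ | _ [f /Z1P fM <-] /=].
    have fs x : f (s (coset E x)) = f x.
      have [e Ee ->] := coset_eqP (sK (coset E x)).
      rewrite (relZ1M fZ) (relZ1_eq0 fZ) // add0r.
      exact: (fixesP _ _ (fixes_conj_action abelE minE)).
    exists (f \o s); last by apply/ffunP => x; rewrite ffunE /= fs.
    apply/Z1P => b c /=.
    by rewrite -{1}(sK b) -{1}(sK c) -cosetM fs (relZ1M fZ).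
  apply/relZ1P; split=> [x y | x Ex]; rewrite !ffunE.
    by rewrite cosetM fM monodromy_coset.
  rewrite (coset_id Ex); apply: (addrI (f 1%g)).
  by rewrite addr0 -{3}[1%g]mulg1 fM -(coset_id (group1 E)) monodromy_coset conj_action1.
apply: inj_card_eq => f f' _ _ /ffunP e; apply/funext => b.
by have := e (s b); rewrite !ffunE sK.
Qed.

(** The image of phi meets E in a normal subgroup of Gamma; if that is E, then phi
    is onto, and otherwise it is trivial, so that phi depends only on rho. *)
Lemma nonsurjective_lifts (G : groupType) (rho : G -> coset_of E) :
  Epi G (coset_of E) rho ->
  (lifts rho `\` Epi G Gamma = (fun t => t \o rho) @` lifts id)%classic.
Proof.
case=> rhoM rhoS; have surj b : exists g, rho g = b.
  have : range rho b by rewrite rhoS.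
  by case=> g _ <-; exists g.
apply/seteqP; split=> [phi [[phiM phiE] nepi] | _ [t [tM tE] <-]]; last first.
  split; first by split=> g; [move=> h; rewrite /= rhoM tM | apply: tE].
  case=> _ tS; have [e Ee] := trivgPn _ (minnormal_neq1 minE); case/negP.
  have : range (t \o rho) e by rewrite tS.
  case=> g _ /= ge; have : rho g = 1%g by rewrite -(tE (rho g)) ge coset_id.
  by rewrite -ge => ->; rewrite (morph_grp1 tM).
have gL : group_set [set e in E | `[< exists g, phi g = e >]].
  apply/group_setP; split.
    by rewrite inE group1; apply/asboolP; exists 1%g; apply: morph_grp1.
  move=> x y /setIdP[Ex /asboolP[g gx]] /setIdP[Ey /asboolP[h hy]].
  by rewrite inE groupM //; apply/asboolP; exists (g * h)%g; rewrite phiM gx hy.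
have L1 : [set e in E | `[< exists g, phi g = e >]] = 1%g.
  apply/eqP; apply: contra_notT nepi => ntL; split=> //.
  have eLE : [set e in E | `[< exists g, phi g = e >]] = E.
    apply: (minnormal_eq minE) => //.
      by apply/fintype.subsetP => e; rewrite inE => /andP[].
    move=> e x /setIdP[Ee /asboolP[g ge]].
    have [h hx] := surj (coset E x); rewrite -phiE in hx.
    have [e' Ee' ->] := coset_eqP (esym hx).
    rewrite inE (memEJ minE) //; apply/asboolP; exists (g ^ h)%g.
    rewrite conjgM (conjg_abelian (abelem_abelian abelE) Ee Ee').
    by rewrite !conjgE !phiM (morph_grpV phiM) ge.
  apply/seteqP; split=> // x _; have [h hx] := surj (coset E x).
  rewrite -phiE in hx; have [e Ee ->] := coset_eqP (esym hx).
  have : e \in [set e in E | `[< exists g, phi g = e >]] by rewrite eLE.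
  by move=> /setIdP[_ /asboolP[g ge]]; exists (g * h)%g; rewrite // phiM ge.
have phi_rho g h : rho g = rho h -> phi g = phi h.
  rewrite -!phiE => /coset_eqP[e Ee egh].
  have : e \in [set e in E | `[< exists g, phi g = e >]].
    rewrite inE Ee; apply/asboolP; exists (g * h^-1)%g.
    by rewrite phiM (morph_grpV phiM) egh mulgK.
  by rewrite L1 => /set1P e1; rewrite egh e1 mul1g.
have [r rK] := choice surj.
exists (phi \o r); last by apply/funext => g /=; apply: phi_rho; rewrite rK.
split=> [b c | b] /=; last by rewrite phiE rK.
by rewrite -phiM; apply: phi_rho; rewrite rhoM !rK.
Qed.

(** A homomorphic section t measures every x in Gamma against t (x E); the
    resulting cocycle is the identity on E. *)
Lemma splitting_cocycle t : lifts id t ->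
  exists2 f, f \in relZ1 act 1%g & {in E, f =1 toV}.
Proof.
case=> tM tE; exists [ffun x => toV (x * (t (coset E x))^-1)%g]; last first.
  by move=> e Ee; rewrite ffunE (coset_id Ee) (morph_grp1 tM) invg1 mulg1.
have tx x : exists2 e, e \in E & t (coset E x) = (e * x)%g.
  by apply: coset_eqP; rewrite tE.
have fE x : (x * (t (coset E x))^-1)%g \in E.
  by have [e Ee ->] := tx x; rewrite invMg mulgA mulgV mul1g groupV.
apply/relZ1P; split=> [x y | _ /set1P ->]; rewrite !ffunE; last first.
  by rewrite (coset_id (group1 E)) (morph_grp1 tM) mulgV abelem_rV_1.
have -> : act x (toV (y * (t (coset E y))^-1)%g)
    = toV ((y * (t (coset E y))^-1) ^ (t (coset E x))^-1)%g.
  have [e Ee ->] := tx x; rewrite -conj_action_toV // conj_actionM.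
  by rewrite [RHS](fixesP _ _ (fixes_conj_action abelE minE)).
rewrite -abelem_rV_M ?memEJ //; congr toV.
by rewrite cosetM tM invMg conjgE invgK !mulgA mulgKV.
Qed.

Lemma coboundary2_twisted :
  coboundary2 sigma chi <-> exists f, twisted_cocycles id f.
Proof.
split=> -[f fE]; exists (fun b => - f b); apply/funext => b; apply/funext => c.
  by rewrite fE /delta1 /= linearN /= !opprD !opprK.
have /(congr1 (@^~ c)) := congr1 (@^~ b) fE; rewrite /delta1 /= linearN /= => e.
by rewrite -[chi b c]opprK -e !opprD.
Qed.

Lemma lifts_nonempty (G : groupType) (rho : G -> coset_of E) f :
  {morph rho : x y / (x * y)%g} -> twisted_cocycles rho f ->
  exists phi, lifts rho phi.
Proof.
move=> rhoM fP; apply/set0P; apply: contraL (card_lifts rhoM) => /eqP ->.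
by rewrite card_eq_sym card_eq0; apply/set0P; exists f.
Qed.

Lemma card_liftsE (G : groupType) (rho : G -> coset_of E) :
  {morph rho : x y / (x * y)%g} ->
  #|` fset_set (lifts rho)| =
  (`[< exists f, twisted_cocycles rho f >] * #|` fset_set (Z1set (sigma \o rho))|)%N.
Proof.
move=> rhoM; rewrite (card_eq_fset_set (card_lifts rhoM)).
case: asboolP => [[f0 f0P] | no]; last first.
  have -> : twisted_cocycles rho = set0.
    by apply/seteqP; split=> // f fP; case: no; exists f.
  by rewrite fset_set0 cardfs0 mul0n.
by rewrite mul1n; apply/card_eq_fset_set/card_twisted_cocycles/f0P.
Qed.

Lemma card_nonsurjective_lifts (G : groupType) (rho : G -> coset_of E) :
  Epi G (coset_of E) rho ->
  #|` fset_set (lifts rho `\` Epi G Gamma)%classic|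
  = (`[< coboundary2 sigma chi >] * #|relZ1 act E|)%N.
Proof.
move=> epi; rewrite (nonsurjective_lifts epi).
have -> : #|` fset_set [set t \o rho | t in lifts id]%classic| = #|` fset_set (lifts id)|.
  apply/card_eq_fset_set/inj_card_eq => t t' _ _ e; apply/funext => b.
  have [_ surj] := epi; have : range rho b by rewrite surj.
  by case=> g _ <-; have := congr1 (@^~ g) e.
rewrite card_liftsE //; congr (nat_of_bool _ * _)%N.
  by apply/asboolP/asboolP => /coboundary2_twisted.
by rewrite (card_eq_fset_set card_Z1_quotient) card_fset_set_finset.
Qed.

End Lifts.

Lemma finite_morphisms (G : groupType) (H : finGroupType) :
  finitely_presented G ->
  finite_set [set f : G -> H | {morph f : x y / (x * y)%g}]%classic.
Proof.
move=> [n [r [x [genx _]]]].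
pose ev (f : G -> H) : {ffun 'I_n -> H} := [ffun i => f (x i)].
rewrite -(eq_finite_set (inj_card_eq (f := ev) _)) => [|f f' /set_mem fM /set_mem f'M ee].
  exact: finite_finset.
apply/funext => g; have [w <-] := genx g.
elim: w => [|[i b] w IHw] /=; first by rewrite !morph_grp1.
rewrite fM f'M IHw; congr (_ * _)%g.
have fxi : f (x i) = f' (x i) by move/ffunP/(_ i): ee; rewrite !ffunE.
by case: b; rewrite // !morph_grpV // fxi.
Qed.
(** * The number of epimorphisms *)

Theorem theorem1
  (G : groupType) (G_fp : finitely_presented G)
  (Gamma : finGroupType) (Gamma_sol : solvable [set: Gamma])
  (q : nat) (q_prime : prime q)
  (E : {group Gamma}) (abelE : q.-abelem E)
  (minE : minnormal E [set: Gamma])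
  (s : coset_of E -> Gamma) (sK : cancel s (coset E)) (s1 : s 1%g = 1%g)
  (cs : seq {group Gamma}) (cs_chief : chief_series cs)
  (kappa : nat) (kappaE : (q ^ kappa)%N = #|EndGamma abelE minE|) :
  let sigma := monodromy abelE minE s in
  let chi := ext_cocycle abelE minE s in
  let zeta := if acts_trivially abelE minE s then 0%N else 1%N in
  let eps (rho : G -> coset_of E) : bool :=
    `[< exists f : G -> 'rV['F_q](E),
          delta1 (sigma \o rho) f = fun g h => - chi (rho g) (rho h) >] in
  let c : bool := `[< coboundary2 sigma chi >] in
  let alpha := num_compl_factors E cs in
  (#|` fset_set (Epi G Gamma)|%fset)%:R =
    (#|E| ^ zeta)%:R *
    \sum_(rho \in Epi G (coset_of E))
      ((eps rho)%:R * q%:R ^+ lmod_dim (H1 (sigma \o rho))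
       - c%:R * (q%:R : rat) ^ (kappa%:Z * (alpha%:Z - 1))) :> rat.
Proof.
move=> sigma chi zeta eps c alpha.
have finE := finite_Epi Gamma G_fp; have finB := finite_Epi (coset_of E) G_fp.
have zetaE : zeta = ~~ fixes (conj_action abelE minE) [set: Gamma].
  by rewrite /zeta (acts_triviallyE abelE minE sK); case: fixes.
have epi_proj phi : Epi G Gamma phi -> Epi G (coset_of E) (coset E \o phi).
  move=> [phiM surj]; split=> [g h /= | ]; first by rewrite phiM (cosetM minE).
  apply/seteqP; split=> // b _; have : range phi (s b) by rewrite surj.
  by case=> g _ gb; exists g; rewrite //= gb sK.
rewrite (card_fibers (h := fun phi : G -> Gamma => coset E \o phi) finE finB epi_proj).
rewrite fsbig_finite //= mulr_sumr natr_sum big_seq [RHS]big_seq.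
apply: eq_bigr => rho; rewrite in_fset_set // => /set_mem epi.
have [rhoM surj] := epi.
have -> : (Epi G Gamma `&` (fun phi : G -> Gamma => coset E \o phi) @^-1` [set rho]
    = lifts rho `&` Epi G Gamma)%classic.
  apply/seteqP; split=> phi [].
    by move=> epiphi phiE; split=> //; split=> [|g]; [case: epiphi | rewrite -phiE].
  by move=> [_ phiE] epiphi; split=> //; apply/funext.
have finL : finite_set (lifts rho).
  by apply: sub_finite_set (finite_morphisms Gamma G_fp) => phi [].
have := cardfsID (fset_set (Epi G Gamma)) (fset_set (lifts rho)).
rewrite -fset_setI // -fset_setD // (card_nonsurjective_lifts abelE minE sK epi).
rewrite (card_liftsE abelE minE sK rhoM) => count.
have {}count : (#|` fset_set (lifts rho `&` Epi G Gamma)%classic|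
    + c * #|relZ1 (conj_action abelE minE) E|
  = eps rho * #|` fset_set (Z1set (sigma \o rho))|)%N := count.
have cE : c%:R * (#|relZ1 (conj_action abelE minE) E|%:R : rat)
    = (#|E| ^ zeta)%:R * (c%:R * (q%:R : rat) ^ (kappa%:Z * (alpha%:Z - 1))).
  case cT: c; last by rewrite !mul0r mulr0.
  have /coboundary2_twisted[f0 f0P] : coboundary2 sigma chi by apply/asboolP.
  have [t tP] := lifts_nonempty sK (fun _ _ => erefl) f0P.
  have [f fZ fE] := splitting_cocycle abelE minE tP.
  by rewrite !mulr1n !mul1r (card_relZ1_E q_prime Gamma_sol cs_chief fZ fE kappaE) -zetaE.
have epsE : ((eps rho * #|` fset_set (Z1set (sigma \o rho))|)%N%:R : rat)
    = (#|E| ^ zeta)%:R * ((eps rho)%:R * q%:R ^+ lmod_dim (H1 (sigma \o rho))).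
  case eT: (eps rho); last by rewrite mul0n !mul0r mulr0.
  rewrite mul1n mulr1n mul1r card_Z1 //.
    by rewrite (card_range_delta0 abelE minE sK surj) -zetaE natrM (natrX _ q).
    by move=> g h v /=; rewrite rhoM (monodromyM abelE minE sK).
  have [f0 f0P] : exists f, twisted_cocycles abelE minE s rho f by apply/asboolP.
  rewrite -(eq_finite_set (card_twisted_cocycles f0P)).
  by rewrite -(eq_finite_set (card_lifts abelE minE sK rhoM)).
move/(congr1 (fun n => n%:R : rat)): count.
rewrite natrD epsE natrM cE => e.
by rewrite [RHS]mulrBr -e addrK.
Qed.
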